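(* There exists a left invariant weak sub-Riemannian metric $g$ on the infinite dimensional Heisenberg group $\mathbb{H}$ such that its associated geodesic (sub-Riemannian) distance $\rho$ is not positive on all couples of distinct points; that is, there exist $p,q\in\mathbb{H}$ with $p\neq q$ and $\rho(p,q)=0$.
   Context: $\ell^2$ is the Hilbert space of real square-summable sequences with its standard scalar product $\langle\cdot,\cdot\rangle$. The infinite dimensional Heisenberg group $\mathbb{H}$ is the Hilbert space $\ell^2\times\ell^2\times\mathbb{R}$ (a Hilbert manifold, with each tangent space $T_p\mathbb{H}$ canonically identified with $\ell^2\times\ell^2\times\mathbb{R}$) equipped with the Lie group operation $$(h_1,h_2,\tau)(h_1',h_2',\tau')=(h_1+h_1',\,h_2+h_2',\,\tau+\tau'+\langle h_1,h_2'\rangle-\langle h_2,h_1'\rangle).$$ The identity is $0$ and the inverse of $p$ is $-p$. For $p=(p_1,p_2,p_3)\in\mathbb{H}$, let $L_p$ be the left multiplication $L_p(r)=pr$; its differential at any point is $(dL_p)(v_1,v_2,v_3)=(v_1,v_2,v_3+\langle p_1,v_2\rangle-\langle p_2,v_1\rangle)$. The horizontal subbundle $H\mathbb{H}$ has fibers $H_p\mathbb{H}=(dL_p)_0(H_0\mathbb{H})$, where $H_0\mathbb{H}=\ell^2\times\ell^2\times\{0\}\subset T_0\mathbb{H}$; equivalently, $v=(v_1,v_2,v_3)\in H_p\mathbb{H}$ if and only if $v_3-\langle p_1,v_2\rangle+\langle p_2,v_1\rangle=0$. A left invariant weak sub-Riemannian metric $g$ on $\mathbb{H}$ is determined by a scalar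 product (symmetric, positive definite bilinear form) $g_0:H_0\mathbb{H}\times H_0\mathbb{H}\to\mathbb{R}$ that is continuous with respect to the Hilbert space topology (it is not required to induce that topology), by setting $g_p(v,w)=g_0\big((dL_{-p})_pv,(dL_{-p})_pw\big)$ for $p\in\mathbb{H}$ and $v,w\in H_p\mathbb{H}$. A horizontal curve is a continuous and piecewise smooth curve $\gamma=(\gamma_1,\gamma_2,\gamma_3):[0,1]\to\mathbb{H}$ such that $\dot\gamma(t)\in H_{\gamma(t)}\mathbb{H}$ for almost every $t\in[0,1]$, i.e. $\dot\gamma_3-\langle\gamma_1,\dot\gamma_2\rangle+\langle\gamma_2,\dot\gamma_1\rangle=0$ almost everywhere. Its length is $\ell_g(\gamma)=\int_0^1\sqrt{g_{\gamma(t)}(\dot\gamma(t),\dot\gamma(t))}\,dt$, and the associated sub-Riemannian distance is $$\rho(p,q)=\inf\{\ell_g(\gamma):\gamma\text{ a horizontal curve with }\gamma(0)=p,\ \gamma(1)=q\}.$$ *)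

(* Defs.v *)
From HB Require Import structures.
From mathcomp Require Import all_boot all_order all_algebra.
From mathcomp Require Import ring lra.
From mathcomp Require Import all_classical all_reals all_analysis.
Set Implicit Arguments.
Unset Strict Implicit.
Unset Printing Implicit Defensive.
Import Order.TTheory GRing.Theory Num.Theory.
Import numFieldNormedType.Exports.
Local Open Scope classical_set_scope.
Local Open Scope ring_scope.

Definition square_summable (R : realType) : {pred (nat -> R)} :=
  fun x => `[< cvgn (series (fun n => x n ^+ 2)) >].

Record ell2 (R : realType) := Ell2 {
  ell2_seq :> nat -> R ;
  ell2_summable : ell2_seq \in @square_summable R
}.

HB.instance Definition _ (R : realType) := [isSub for @ell2_seq R].
HB.instance Definition _ (R : realType) := [Choice of ell2 R by <:].

Section Ell2Lmodule.
Context {R : realType}.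
Implicit Types x y : nat -> R.

Lemma square_summableP x :
  x \in @square_summable R <-> cvgn (series (fun n => x n ^+ 2)).
Proof. by split => [/asboolP|? //]; [|apply/asboolP]. Qed.

Lemma square_summable_submod : submod_closed (@square_summable R).
Proof.
split=> [|a x y /square_summableP sx /square_summableP sy].
  apply/square_summableP; rewrite (_ : (fun n : nat => _) = fun=> 0).
    rewrite (_ : series _ = fun=> 0); first exact: is_cvg_cst.
    by apply/funext => n; rewrite /series /= big1.
  by apply/funext => n /=; rewrite expr0n.
apply/square_summableP.
apply: (@series_le_cvg _ _ ((2 * a ^+ 2) *: (fun n => x n ^+ 2)
                            + 2 *: (fun n => y n ^+ 2))).
- by move=> n; exact: sqr_ge0.
- move=> n; rewrite addr_ge0//.
    by rewrite mulr_ge0// ?sqr_ge0// mulr_ge0// sqr_ge0.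
  by rewrite mulr_ge0// sqr_ge0.
- move=> n /=; rewrite -[leRHS]/(2 * a ^+ 2 * x n ^+ 2 + 2 * y n ^+ 2).
  rewrite -[leLHS]/((a * x n + y n) ^+ 2).
  have := sqr_ge0 (a * x n - y n); nra.
- by apply: is_cvg_seriesD; apply: is_cvg_seriesZ.
Qed.

HB.instance Definition _ :=
  GRing.isSubmodClosed.Build R (nat -> R) (@square_summable R)
    square_summable_submod.
HB.instance Definition _ := [SubChoice_isSubLmodule of ell2 R by <:].

End Ell2Lmodule.

Definition ell2_dot (R : realType) (x y : ell2 R) : R :=
  limn (series (fun n => x n * y n)).

Section Ell2Normed.
Context {R : realType}.
Implicit Types x y z : ell2 R.

Lemma ell2_dot_cvg x y : cvgn (series (fun n => x n * y n)).
Proof.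
have /square_summableP sx := ell2_summable x.
have /square_summableP sy := ell2_summable y.
apply: normed_cvg.
apply: (@series_le_cvg _ _ ((fun n => x n ^+ 2) + (fun n => y n ^+ 2))).
- by move=> n /=.
- by move=> n; rewrite addr_ge0// sqr_ge0.
- move=> n /=; rewrite -[leRHS]/(x n ^+ 2 + y n ^+ 2) normrM.
  rewrite -(real_normK (num_real (x n))) -(real_normK (num_real (y n))).
  have := sqr_ge0 (`|x n| - `|y n|).
  have := normr_ge0 (x n); have := normr_ge0 (y n); nra.
- exact: is_cvg_seriesD.
Qed.

Lemma ell2_dotC x y : ell2_dot x y = ell2_dot y x.
Proof. by congr (limn (series _)); apply/funext => n; rewrite mulrC. Qed.

Lemma ell2_dotDl a x y z :
  ell2_dot (a *: x + y) z = a * ell2_dot x z + ell2_dot y z.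
Proof.
rewrite /ell2_dot.
rewrite (_ : (fun n => (a *: x + y) n * z n) =
  a *: (fun n => x n * z n) + (fun n => y n * z n)); last first.
  by apply/funext => n; rewrite [in LHS]mulrDl -mulrA.
have cxz := @ell2_dot_cvg x z; have cyz := @ell2_dot_cvg y z.
have czx := is_cvg_seriesZ (k := a) cxz.
by rewrite lim_seriesD // lim_seriesZ.
Qed.

Lemma ell2_dot0l z : ell2_dot 0 z = 0.
Proof.
by have := ell2_dotDl 1 0 0 z; rewrite scaler0 addr0 mul1r => h; lra.
Qed.

Lemma ell2_dotZl a x z : ell2_dot (a *: x) z = a * ell2_dot x z.
Proof. by have := ell2_dotDl a x 0 z; rewrite ell2_dot0l !addr0. Qed.

Lemma ell2_dotD x y z : ell2_dot (x + y) z = ell2_dot x z + ell2_dot y z.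
Proof. by have := ell2_dotDl 1 x y z; rewrite scale1r mul1r. Qed.

Lemma ell2_dotN x z : ell2_dot (- x) z = - ell2_dot x z.
Proof. by rewrite -scaleN1r ell2_dotZl mulN1r. Qed.

Lemma ell2_dot0r z : ell2_dot z 0 = 0.
Proof. by rewrite ell2_dotC ell2_dot0l. Qed.

Lemma ell2_dotZr a x z : ell2_dot z (a *: x) = a * ell2_dot z x.
Proof. by rewrite ell2_dotC ell2_dotZl ell2_dotC. Qed.

Lemma ell2_dotDr x y z : ell2_dot z (x + y) = ell2_dot z x + ell2_dot z y.
Proof. by rewrite ell2_dotC ell2_dotD !(ell2_dotC _ z). Qed.

Lemma ell2_dotNr x z : ell2_dot z (- x) = - ell2_dot z x.
Proof. by rewrite ell2_dotC ell2_dotN ell2_dotC. Qed.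

Lemma ell2_sqr_le_dot x n : x n ^+ 2 <= ell2_dot x x.
Proof.
have -> : ell2_dot x x = limn (series (fun n => x n ^+ 2)).
  by congr (limn (series _)); apply/funext => k; rewrite expr2.
have sx : cvgn (series (fun n => x n ^+ 2)).
  exact/square_summableP/ell2_summable.
apply: le_trans (nondecreasing_cvgn_le _ sx n.+1).
  by rewrite /series /= big_nat_recr//= lerDr sumr_ge0// => i _; exact: sqr_ge0.
by apply: nondecreasing_series => i _ _; exact: sqr_ge0.
Qed.

Lemma ell2_dot_ge0 x : 0 <= ell2_dot x x.
Proof. exact: le_trans (sqr_ge0 _) (ell2_sqr_le_dot x 0%N). Qed.

Lemma ell2_dot_eq0 x : ell2_dot x x = 0 -> x = 0.
Proof.
move=> x0; apply/val_inj/funext => n; apply/eqP.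
by have := ell2_sqr_le_dot x n; rewrite x0 => h; rewrite -sqrf_eq0 eq_le h sqr_ge0.
Qed.

Lemma ell2_cauchy_schwarz x y :
  (ell2_dot x y) ^+ 2 <= ell2_dot x x * ell2_dot y y.
Proof.
set a := ell2_dot x x; set b := ell2_dot x y; set c := ell2_dot y y.
have [y0|y0] := eqVneq c 0.
  by rewrite /b (ell2_dot_eq0 y0) ell2_dot0r expr0n mulr_ge0// ell2_dot_ge0.
have cp : 0 < c by rewrite lt0r y0 ell2_dot_ge0.
have := ell2_dot_ge0 (c *: x - b *: y).
have -> : ell2_dot (c *: x - b *: y) (c *: x - b *: y) = c * (a * c - b ^+ 2).
  rewrite !(ell2_dotD, ell2_dotDr, ell2_dotN, ell2_dotNr, ell2_dotZl, ell2_dotZr).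
  rewrite (ell2_dotC y x) -/a -/b -/c; ring.
by rewrite pmulr_rge0// subr_ge0.
Qed.

Definition ell2_norm x : R := Num.sqrt (ell2_dot x x).

Lemma ell2_dot_le_norm x y : `|ell2_dot x y| <= ell2_norm x * ell2_norm y.
Proof.
by rewrite -sqrtrM ?ell2_dot_ge0// -sqrtr_sqr ler_wsqrtr// ell2_cauchy_schwarz.
Qed.

Lemma ler_ell2_normD x y : ell2_norm (x + y) <= ell2_norm x + ell2_norm y.
Proof.
have nx := sqrtr_ge0 (ell2_dot x x); have ny := sqrtr_ge0 (ell2_dot y y).
rewrite -[leRHS]ger0_norm ?addr_ge0// -sqrtr_sqr ler_wsqrtr//.
rewrite !(ell2_dotD, ell2_dotDr) (ell2_dotC y x) sqrrD !sqr_sqrtr ?ell2_dot_ge0//.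
have := le_trans (ler_norm _) (ell2_dot_le_norm x y).
rewrite /ell2_norm; lra.
Qed.

Lemma ell2_normZ (a : R) x : ell2_norm (a *: x) = `|a| * ell2_norm x.
Proof.
rewrite /ell2_norm ell2_dotZl ell2_dotZr mulrA -expr2 sqrtrM ?sqr_ge0//.
by rewrite sqrtr_sqr.
Qed.

Lemma ell2_norm0_eq0 x : ell2_norm x = 0 -> x = 0.
Proof.
move/eqP; rewrite sqrtr_eq0 => h; apply: ell2_dot_eq0.
by apply/eqP; rewrite eq_le h ell2_dot_ge0.
Qed.

HB.instance Definition _ := Lmodule_isNormed.Build R (ell2 R)
  ler_ell2_normD ell2_normZ ell2_norm0_eq0.

End Ell2Normed.

(* The norm on a product of normed modules is the maximum of the norms; it
   induces the same topology as the Hilbert norm. *)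
Definition heis (R : realType) : Type := (ell2 R * ell2 R * R)%type.
HB.instance Definition _ (R : realType) :=
  NormedModule.copy (heis R) (ell2 R * ell2 R * R)%type.

Definition hmul (R : realType) (p q : heis R) : heis R :=
  (p.1.1 + q.1.1, p.1.2 + q.1.2,
   p.2 + q.2 + ell2_dot p.1.1 q.1.2 - ell2_dot p.1.2 q.1.1).

(* the differential of [hmul p], the same at every point: [diff_hmul] *)
Definition dL (R : realType) (p v : heis R) : heis R :=
  (v.1.1, v.1.2, v.2 + ell2_dot p.1.1 v.1.2 - ell2_dot p.1.2 v.1.1).

Definition horizontal (R : realType) (p : heis R) : set (heis R) :=
  dL p @` [set v | v.2 = 0].

(* The scalar product lives on the horizontal space at 0, identified with
   ell2 * ell2 by forgetting the zero third coordinate; [horizontal_dLN] shows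
   that [metric_at] forgets nothing on horizontal vectors. *)
Record weak_subriemannian (R : realType) := WeakSubRiemannian {
  g0 :> ell2 R * ell2 R -> ell2 R * ell2 R -> R ;
  g0_sym : forall v w, g0 v w = g0 w v ;
  g0_linear : forall w, scalar (g0^~ w) ;
  g0_pos : forall v, v != 0 -> 0 < g0 v v ;
  g0_continuous : continuous (fun vw => g0 vw.1 vw.2)
}.

Definition metric_at (R : realType) (g : weak_subriemannian R)
    (p v w : heis R) : R :=
  g (dL (- p) v).1 (dL (- p) w).1.

Section Curves.
Context {R : realType}.
Implicit Types (gamma : R -> heis R) (p q : heis R).

Definition smooth (V : normedModType R) (f : R -> V) :=
  forall n t, derivable (derive1n n f) t 1.

(* On each closed piece of the subdivision, [gamma] is the restriction of a
   smooth map on R, i.e. it is smooth up to the endpoints. *)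
Definition piecewise_smooth gamma := exists2 s : seq R, itv_partition 0 1 s &
  forall i, (i < size s)%N -> exists2 f : R -> heis R, smooth f &
    {in `[nth 0 (0 :: s) i, nth 0 s i], gamma =1 f}.

Definition horizontal_curve gamma :=
  [/\ {within `[0, 1], continuous gamma},
      piecewise_smooth gamma &
      {ae @lebesgue_measure R, forall t, t \in `[0, 1] ->
         horizontal (gamma t) (derive1 gamma t)}].

(* [derive1 gamma] is arbitrary at the finitely many corners, a null set. *)
Definition curve_length (g : weak_subriemannian R) gamma : \bar R :=
  (\int[lebesgue_measure]_(t in `[0%R, 1%R])
     (Num.sqrt (metric_at g (gamma t) (derive1 gamma t) (derive1 gamma t)))%:E)%E.

(* an infimum in [0, +oo]; +oo if no horizontal curve joins [p] to [q] *)
Definition rho (g : weak_subriemannian R) p q : \bar R :=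
  ereal_inf [set curve_length g gamma | gamma in
    [set gamma | [/\ horizontal_curve gamma, gamma 0 = p & gamma 1 = q]]].

End Curves.

Section HeisenbergFacts.
Context {R : realType}.
Implicit Types p q r v : heis R.

Lemma hmulA p q r : hmul p (hmul q r) = hmul (hmul p q) r.
Proof.
rewrite /hmul /= !addrA !ell2_dotD !ell2_dotDr; congr (_, _, _); ring.
Qed.

Lemma hmul0p p : hmul 0 p = p.
Proof.
by case: p => [[a b] c]; rewrite /hmul /= !ell2_dot0l !add0r subr0 addr0.
Qed.

Lemma hmulNp p : hmul (- p) p = 0.
Proof.
case: p => [[a b] c]; rewrite /hmul /= !ell2_dotN !addNr add0r.
by rewrite (ell2_dotC b a) opprK addNr.
Qed.

Lemma horizontalP p v : horizontal p v <->
  v.2 - ell2_dot p.1.1 v.1.2 + ell2_dot p.1.2 v.1.1 = 0.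
Proof.
split=> [[w /= w0 <-] /=|h]; first by rewrite w0; ring.
exists (v.1, 0) => //; case: v h => [[a b] c] /= h.
rewrite /dL /=; congr (_, _, _); lra.
Qed.

Lemma horizontal_dLN p v : horizontal p v -> (dL (- p) v).2 = 0.
Proof. by move=> /horizontalP /= h; rewrite !ell2_dotN; lra. Qed.

Lemma ell2_dot_linear (x : ell2 R) : linear (ell2_dot x : _ -> R^o).
Proof. by move=> a y z; rewrite ell2_dotDr ell2_dotZr. Qed.

HB.instance Definition _ (x : ell2 R) :=
  GRing.isLinear.Build R (ell2 R) R^o _ (ell2_dot x) (ell2_dot_linear x).

Lemma ell2_dot_continuous (x : ell2 R) : continuous (ell2_dot x).
Proof.
apply: (@bounded_linear_continuous _ _ R^o); apply/linear_boundedP.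
exists (ell2_norm x); split=> [|M xM y]; first exact: num_real.
apply: le_trans (ell2_dot_le_norm x y) _.
by rewrite ler_wpM2r ?sqrtr_ge0// ltW.
Qed.

Lemma dL_linear p : linear (dL p).
Proof.
move=> a [[v1 v2] v3] [[w1 w2] w3]; rewrite /dL /= !ell2_dotDr !ell2_dotZr.
congr (_, _, _); rewrite /= /GRing.scale /=; ring.
Qed.

HB.instance Definition _ p :=
  GRing.isLinear.Build R (heis R) (heis R) _ (dL p) (dL_linear p).

Lemma dL_continuous p : continuous (dL p).
Proof.
move=> v.
have c1 : (fun w : heis R => w.1) @ v --> v.1 by exact: cvg_fst.
have c2 : (fun w : heis R => w.2) @ v --> v.2 by exact: cvg_snd.
have c11 : (fun w : heis R => w.1.1) @ v --> v.1.1.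
  exact: (cvg_comp _ _ c1 cvg_fst).
have c12 : (fun w : heis R => w.1.2) @ v --> v.1.2.
  exact: (cvg_comp _ _ c1 cvg_snd).
have c3 : (fun w : heis R => w.2 + ell2_dot p.1.1 w.1.2 - ell2_dot p.1.2 w.1.1)
    @ v --> v.2 + ell2_dot p.1.1 v.1.2 - ell2_dot p.1.2 v.1.1.
  apply: cvgB; first apply: cvgD => //.
  - exact: (cvg_comp _ _ c12 (@ell2_dot_continuous _ _)).
  - exact: (cvg_comp _ _ c11 (@ell2_dot_continuous _ _)).
exact: cvg_pair (cvg_pair c11 c12) c3.
Qed.

Lemma diff_hmul p r : is_diff r (hmul p) (dL p).
Proof.
have -> : hmul p = cst p + dL p.
  apply/funext => -[[q1 q2] q3]; rewrite /hmul /dL.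
  by congr (_, _, _) => /=; rewrite !addrA.
rewrite -[X in is_diff _ _ X]add0r; apply: is_diffD.
apply: DiffDef; first exact/linear_differentiable/dL_continuous.
exact/diff_lin/dL_continuous.
Qed.

End HeisenbergFacts.

(* Main.v *)
Require Import Defs.
From HB Require Import structures.
From mathcomp Require Import all_boot all_order all_algebra.
From mathcomp Require Import ring lra.
From mathcomp Require Import all_classical all_reals all_analysis.
From mathcomp Require Import measurable_realfun.
Set Implicit Arguments.
Unset Strict Implicit.
Unset Printing Implicit Defensive.
Import Order.TTheory GRing.Theory Num.Theory.
Import numFieldNormedType.Exports.
Local Open Scope classical_set_scope.
Local Open Scope ring_scope.

(* In the metric g0(v, w) = sum_n (v1_n w1_n + v2_n w2_n) / (n + 1)^2 the n-th
   coordinate plane is shrunk by the factor 1 / (n + 1), whereas the vertical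
   displacement of the horizontal lift of a planar loop only depends on the
   Euclidean area it encloses.  One and the same loop, drawn in each of the
   coordinate planes in turn, thus lifts to horizontal curves from 0 to a fixed
   point (0, 0, 1 / 15) whose lengths are O(1 / (n + 1)). *)

(** * Smoothness of curves with polynomial coefficients *)

Section PolynomialCurves.
Context {R : realType} {V : normedModType R}.
Implicit Types (p q r : {poly R}) (A B C : V) (t : R).

(** The difference quotient is that of [horner p] times the fixed vector [A], so its limit comes
    from the scalar case. *)
Lemma is_derive_hornerZ p A t :
  is_derive t 1 (fun s => p.[s] *: A) (p^`().[t] *: A).
Proof.
have /cvg_ex[l pl] := @derivable_horner R p t.
have le : l = p^`().[t].
  by rewrite derivE derive1E; apply/esym/cvg_lim.
have cA : (fun h => h^-1 *: (((fun s => p.[s] *: A) \o shift t) (h *: 1)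
    - p.[t] *: A)) @ 0^' --> p^`().[t] *: A.
  rewrite -le (_ : (fun h => _) = (fun h =>
    (h^-1 *: ((horner p \o shift t) (h *: 1) - p.[t])) *: A)).
    exact: cvgZr_tmp.
  by apply/funext => h /=; rewrite -scalerBl scalerA.
by apply: DeriveDef; [apply/cvg_ex; eexists; exact: cA|exact: cvg_lim].
Qed.

Definition pcurve p q r A B C t : V := p.[t] *: A + q.[t] *: B + r.[t] *: C.

Lemma is_derive_pcurve p q r A B C t :
  is_derive t 1 (pcurve p q r A B C) (pcurve p^`() q^`() r^`() A B C t).
Proof.
exact: is_deriveD (is_deriveD (is_derive_hornerZ p A t)
  (is_derive_hornerZ q B t)) (is_derive_hornerZ r C t).
Qed.

Lemma derive1_pcurve p q r A B C :
  derive1 (pcurve p q r A B C) = pcurve p^`() q^`() r^`() A B C.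
Proof.
apply/funext => t; rewrite derive1E.
by have ? := is_derive_pcurve p q r A B C t; rewrite derive_val.
Qed.

Lemma derivable_pcurve p q r A B C t : derivable (pcurve p q r A B C) t 1.
Proof. by case: (is_derive_pcurve p q r A B C t). Qed.

(** Differentiation sends a [pcurve] to the [pcurve] of the derived polynomials, so the induction on
    the order must generalize over [p], [q], [r]. *)
Lemma smooth_pcurve p q r A B C : smooth (pcurve p q r A B C).
Proof.
move=> n t; elim: n p q r => [|n IHn] p q r; first exact: derivable_pcurve.
by rewrite derive1Sn derive1_pcurve.
Qed.

Lemma continuous_pcurve p q r A B C : continuous (pcurve p q r A B C).
Proof.
move=> t; apply/differentiable_continuous/derivable1_diffP.
exact: derivable_pcurve.
Qed.

End PolynomialCurves.

(** * The weak metric obtained from a diagonal contraction of the sequence space *)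

Section WeightedMetric.
Context {R : realType}.
Implicit Types (x y : ell2 R) (v w : ell2 R * ell2 R).

Lemma shrink_seq_subproof x :
  (fun n => x n / n.+1%:R) \in @square_summable R.
Proof.
apply/square_summableP; apply: series_le_cvg.
- by move=> n; exact: sqr_ge0.
- by move=> n; exact: (sqr_ge0 (x n)).
- move=> n; rewrite exprMn ler_piMr ?sqr_ge0// exprVn invf_le1 ?exprn_gt0//.
  by rewrite exprn_ege1// ler1n.
- exact/square_summableP/ell2_summable.
Qed.

(** The metric is the standard scalar product pulled back along this operator: linearity gives
    bilinearity, injectivity gives positivity, and norm at most 1 gives continuity. *)
Definition shrink x : ell2 R := Ell2 (shrink_seq_subproof x).

Lemma shrink_linear : linear shrink.
Proof.
by move=> a x y; apply/val_inj/funext => n; rewrite /= mulrDl -mulrA.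
Qed.

HB.instance Definition _ :=
  GRing.isLinear.Build R (ell2 R) (ell2 R) _ shrink shrink_linear.

Lemma shrink_inj x : shrink x = 0 -> x = 0.
Proof.
move=> /(congr1 (@ell2_seq R)) x0; apply/val_inj/funext => n.
by have /eqP := congr1 (@^~ n) x0; rewrite mulf_eq0 invr_eq0 pnatr_eq0 orbF => /eqP.
Qed.

Lemma shrink_dot_le x : ell2_dot (shrink x) (shrink x) <= ell2_dot x x.
Proof.
apply: ler_lim; [exact: ell2_dot_cvg..|near=> n].
apply: ler_sum => i _ /=; rewrite -!expr2 exprMn ler_piMr ?sqr_ge0//.
by rewrite exprVn invf_le1 ?exprn_gt0// exprn_ege1// ler1n.
Unshelve. all: by end_near. Qed.

Lemma shrink_continuous : continuous shrink.
Proof.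
apply/linear_bounded_continuous/linear_boundedP.
exists 1; split=> [|M M1 x]; first exact: num_real.
rewrite (@le_trans _ _ `|x|)// ?ler_peMl// ?(ltW M1)//.
by rewrite ler_wsqrtr// shrink_dot_le.
Qed.

(** Polarization reduces joint continuity of the scalar product, which is stronger than
    [ell2_dot_continuous], to continuity of the norm. *)
Lemma ell2_dot_polar x y :
  ell2_dot x y = 4^-1 * (`|x + y| ^+ 2 - `|x - y| ^+ 2).
Proof.
rewrite /Num.norm /= /ell2_norm !sqr_sqrtr ?ell2_dot_ge0//.
rewrite !(ell2_dotD, ell2_dotDr, ell2_dotN, ell2_dotNr) (ell2_dotC y x).
by field.
Qed.

Lemma cvg_ell2_dot T (F : set_system T) (FF : Filter F) (f g : T -> ell2 R) x y :
  f @ F --> x -> g @ F --> y ->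
  (fun t => ell2_dot (f t) (g t)) @ F --> ell2_dot x y.
Proof.
move=> fx gy; rewrite ell2_dot_polar.
rewrite (_ : (fun t => _) =
  fun t => 4^-1 * (`|f t + g t| ^+ 2 - `|f t - g t| ^+ 2)); last first.
  by apply/funext => t; rewrite ell2_dot_polar.
have sqr_norm (h : T -> ell2 R) z :
    h @ F --> z -> (fun t => `|h t| ^+ 2) @ F --> `|z| ^+ 2.
  by move=> /cvg_norm hz; rewrite expr2; exact: (cvgM hz hz).
by apply: cvgMl_tmp; apply: cvgB; apply: sqr_norm; [exact: cvgD|exact: cvgB].
Qed.

Definition weighted_dot v w : R :=
  ell2_dot (shrink v.1) (shrink w.1) + ell2_dot (shrink v.2) (shrink w.2).

Lemma weighted_dot_sym v w : weighted_dot v w = weighted_dot w v.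
Proof. by congr +%R; exact: ell2_dotC. Qed.

Lemma weighted_dot_linear w : scalar (weighted_dot^~ w).
Proof.
by move=> a u v; rewrite /weighted_dot !linearP !ell2_dotDl /=; ring.
Qed.

Lemma weighted_dot_pos v : v != 0 -> 0 < weighted_dot v v.
Proof.
move=> v0; rewrite lt0r addr_ge0 ?ell2_dot_ge0// andbT.
apply: contra v0; rewrite paddr_eq0 ?ell2_dot_ge0//.
case: v => a b /= /andP[/eqP/ell2_dot_eq0/shrink_inj->].
by move=> /eqP/ell2_dot_eq0/shrink_inj->.
Qed.

Lemma weighted_dot_continuous :
  continuous (fun vw => weighted_dot vw.1 vw.2).
Proof.
move=> vw.
have c1 : fst @ vw --> vw.1 by exact: cvg_fst.
have c2 : snd @ vw --> vw.2 by exact: cvg_snd.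
have sc T (F : set_system T) (FF : Filter F) (f : T -> ell2 R) x :
    f @ F --> x -> (shrink \o f) @ F --> shrink x.
  by move=> fx; exact: (cvg_comp _ _ fx (@shrink_continuous x)).
apply: cvgD; apply: cvg_ell2_dot; apply: sc.
- exact: (cvg_comp _ _ c1 cvg_fst).
- exact: (cvg_comp _ _ c2 cvg_fst).
- exact: (cvg_comp _ _ c1 cvg_snd).
- exact: (cvg_comp _ _ c2 cvg_snd).
Qed.

Definition weighted_metric : weak_subriemannian R :=
  WeakSubRiemannian weighted_dot_sym weighted_dot_linear weighted_dot_pos
    weighted_dot_continuous.

Lemma delta_seq_cvg (n : nat) (a : R) :
  series (fun k => (k == n)%:R * a) @ \oo --> a.
Proof.
(* The partial sums are constant once they include the index [n]. *)
apply: cvg_near_cst; near=> m.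
have nm : (n < m)%N by near: m; exact: nbhs_infty_gt.
rewrite /series /= big_mkord (bigD1 (Ordinal nm))//= eqxx mul1r big1 ?addr0//.
by move=> i; rewrite -val_eqE /= => /negbTE->; rewrite mul0r.
Unshelve. all: by end_near. Qed.

Lemma delta_seq_subproof (n : nat) :
  (fun k => (k == n)%:R) \in @square_summable R.
Proof.
apply/square_summableP; apply/cvg_ex; exists 1.
rewrite (_ : (fun k => _) = (fun k => (k == n)%:R * 1)).
  exact: delta_seq_cvg.
by apply/funext => k; rewrite mulr1; case: eqP => _; rewrite ?expr1n ?expr0n.
Qed.

Definition delta n : ell2 R := Ell2 (delta_seq_subproof n).

Lemma dot_delta n : ell2_dot (delta n) (delta n) = 1.
Proof.
apply/cvg_lim => //.
rewrite (_ : (fun k => _) = (fun k => (k == n)%:R * 1)).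
  exact: delta_seq_cvg.
by apply/funext => k /=; case: eqP => _; rewrite ?mulr1 ?mulr0.
Qed.

(** The basis vectors are eigenvectors of [shrink]; this is the source of the decay of the
    lengths. *)
Lemma shrink_delta (a : R) n :
  shrink (a *: delta n) = (a / n.+1%:R) *: delta n.
Proof.
apply/val_inj/funext => k.
rewrite -[LHS]/(a * (k == n)%:R / _) -[RHS]/(a / _ * (k == n)%:R).
by case: eqP => [->|_]; rewrite ?mulr1 ?mulr0 ?mul0r.
Qed.

End WeightedMetric.

(** * The lifted loops: horizontality, length and endpoints *)

Section Loop.
Context {R : realType}.
Implicit Types (n : nat) (t : R).

(* The loop is (u, u (2t - 1)) with u = t - t^2; then loop_z' = loop_x loop_y' -
   loop_y loop_x' reduces to u^2 (2t - 1)' = 2 u^2. *)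
Definition loop_x : {poly R} := 'X - 'X^2.
Definition loop_y : {poly R} := loop_x * (2%:P * 'X - 1).
Definition loop_z : {poly R} :=
  (2 / 3)%:P * 'X^3 - 'X^4 + (2 / 5)%:P * 'X^5.

Definition loop n : R -> heis R :=
  pcurve loop_x loop_y loop_z (delta n, 0, 0 : R) (0, delta n, 0 : R) (0, 0, 1 : R).

(** The polynomials are arbitrary so that the formula serves both the loop and its velocity. *)
Lemma pcurve_heisE (p q r : {poly R}) n t :
  pcurve p q r ((delta n, 0, 0) : heis R) (0, delta n, 0) (0, 0, 1) t =
  (p.[t] *: delta n, q.[t] *: delta n, r.[t]).
Proof.
by congr (_, _, _); rewrite /= ?scaler0 ?addr0 ?add0r// [LHS]mulr1.
Qed.

Lemma loopE n t : loop n t =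
  (loop_x.[t] *: delta n, loop_y.[t] *: delta n, loop_z.[t]).
Proof. exact: pcurve_heisE. Qed.

Lemma derive1_loopE n t : derive1 (loop n) t =
  (loop_x^`().[t] *: delta n, loop_y^`().[t] *: delta n, loop_z^`().[t]).
Proof. by rewrite derive1_pcurve; exact: pcurve_heisE. Qed.

Lemma loop_xE t : loop_x.[t] = t - t ^+ 2.
Proof. by rewrite /loop_x !hornerE. Qed.

Lemma loop_yE t : loop_y.[t] = (t - t ^+ 2) * (2 * t - 1).
Proof. by rewrite /loop_y /loop_x !hornerE. Qed.

Lemma loop_zE t : loop_z.[t] = 2 / 3 * t ^+ 3 - t ^+ 4 + 2 / 5 * t ^+ 5.
Proof. by rewrite /loop_z !hornerE. Qed.

Lemma deriv_loop_xE t : loop_x^`().[t] = 1 - 2 * t.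
Proof. by rewrite /loop_x !poly.derivE !hornerE /=; ring. Qed.

Lemma deriv_loop_yE t : loop_y^`().[t] = - 1 + 6 * t - 6 * t ^+ 2.
Proof. by rewrite /loop_y /loop_x !poly.derivE !hornerE /=; ring. Qed.

Lemma deriv_loop_zE t : loop_z^`().[t] = 2 * (t - t ^+ 2) ^+ 2.
Proof. by rewrite /loop_z !poly.derivE !hornerE /=; field. Qed.

(** Since [delta n] is a unit vector, the condition is a polynomial identity free of [n]; hence one
    height [loop_z] suits all planes. *)
Lemma horizontal_loop n t : horizontal (loop n t) (derive1 (loop n) t).
Proof.
apply/horizontalP; rewrite derive1_loopE loopE /= !ell2_dotZl !ell2_dotZr.
rewrite dot_delta loop_xE loop_yE deriv_loop_xE deriv_loop_yE deriv_loop_zE.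
ring.
Qed.

Lemma horizontal_curve_loop n : horizontal_curve (loop n).
Proof.
split.
- exact/continuous_subspaceT/continuous_pcurve.
(* The curve is smooth on all of [R], so a single piece suffices. *)
- exists [:: 1]; first exact: itv_partition1.
  by move=> i _; exists (loop n) => //; exact: smooth_pcurve.
- by apply: aeW => t _; exact: horizontal_loop.
Qed.

(** Left translation alters only the third coordinate of the velocity, which [metric_at] drops; only
    the planar speed remains, scaled by [shrink_delta]. *)
Lemma metric_at_loop n t :
  metric_at weighted_metric (loop n t) (derive1 (loop n) t) (derive1 (loop n) t)
  = ((1 - 2 * t) ^+ 2 + (- 1 + 6 * t - 6 * t ^+ 2) ^+ 2) / n.+1%:R ^+ 2.
Proof.
rewrite derive1_loopE /metric_at /= /weighted_dot /= !shrink_delta.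
rewrite !(ell2_dotZl, ell2_dotZr) dot_delta deriv_loop_xE deriv_loop_yE.
have : n.+1%:R != 0 :> R by rewrite pnatr_eq0.
by move: (n.+1%:R : R) => c c0; field.
Qed.

(** The speed is bounded pointwise by [2 / n.+1%:R] on an interval of measure 1. *)
Lemma curve_length_loop n :
  (curve_length weighted_metric (loop n) <= (2 / n.+1%:R)%:E)%E.
Proof.
have n0 : 0 < n.+1%:R :> R by [].
rewrite /curve_length; under eq_integral do rewrite metric_at_loop.
apply: (@le_trans _ _
  (\int[lebesgue_measure]_(t in `[0%R, 1%R]) (2 / n.+1%:R)%:E)%E); last first.
  by rewrite integral_cst//= lebesgue_measure_itv/= lte01 sube0 mule1.
apply: ge0_le_integral => //.
- apply/measurable_EFinP/measurable_funTS.
  (* Writing the squared speed as a polynomial makes the integrand continuous, hence measurable. *)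
  pose s : {poly R} := (n.+1%:R ^- 2)%:P * ((1 - 2%:P * 'X) ^+ 2 +
    (- 1 + 6%:P * 'X - 6%:P * 'X^2) ^+ 2).
  rewrite [X in measurable_fun _ X](_ : _ = @Num.sqrt R \o horner s).
    apply: continuous_measurable_fun => t; apply: continuous_comp.
      exact: continuous_horner.
    exact: sqrt_continuous.
  by apply/funext => t /=; rewrite /s !hornerE mulrC.
- move=> t /=; rewrite in_itv /= => /andP[t0 t1]; rewrite lee_fin.
  rewrite -[leRHS]ger0_norm ?divr_ge0// -sqrtr_sqr ler_wsqrtr//.
  rewrite expr_div_n ler_wpM2r ?invr_ge0 ?exprn_ge0 ?ltW//.
  (* Both planar velocity coordinates lie in [-1, 1], so their squares sum to at most 2, below the
     required 2 ^ 2. *)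
  have : -1 <= 1 - 2 * t <= 1 by lra.
  have : -1 <= - 1 + 6 * t - 6 * t ^+ 2 <= 1 by nra.
  move: (1 - 2 * t) (- 1 + 6 * t - 6 * t ^+ 2) => a b ? ?; nra.
Qed.

Lemma loop0 n : loop n 0 = 0.
Proof.
rewrite loopE loop_xE loop_yE loop_zE !expr0n /=.
by rewrite subr0 mul0r scale0r !mulr0 subr0 addr0.
Qed.

(** The height is 2/3 - 1 + 2/5 = 1/15, the integral of 2 (t - t^2)^2 over [0, 1]. *)
Lemma loop1 n : loop n 1 = (0, 0, 15^-1).
Proof.
rewrite loopE loop_xE loop_yE loop_zE !expr1n subrr mul0r scale0r.
by congr (_, _); field.
Qed.

End Loop.

(** * Vanishing of the distance between two distinct points *)

Theorem theorem1p2 (R : realType) :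
  exists (g : weak_subriemannian R) (p q : heis R), p <> q /\ rho g p q = 0%E.
Proof.
exists weighted_metric, 0, (0, 0, 15^-1); split.
  by case=> /esym/eqP; rewrite invr_eq0 pnatr_eq0.
apply/eqP; rewrite eq_le; apply/andP; split; last first.
  (* Every length is the integral of a nonnegative function, so 0 is a lower bound. *)
  apply: le_ereal_inf_tmp => _ [gamma _ <-].
  by apply: integral_ge0 => t _; rewrite lee_fin sqrtr_ge0.
apply/lee_addgt0Pr => e e0; rewrite add0e.
(* By the Archimedean property [n] exceeds 2 / e, so the loop in plane [n] has length at most
   [e]. *)
pose n := Num.bound (2 / e).
apply: (@le_trans _ _ (2 / n.+1%:R)%:E); last first.
  rewrite lee_fin ler_pdivrMr// -ler_pdivrMl// mulrC.
  rewrite (le_trans (ltW (archi_boundP _)))// ?divr_ge0 ?ltW//.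
  by rewrite -/n ltr_nat.
apply: le_trans (curve_length_loop n).
apply: ereal_inf_lbound; exists (loop n) => //; split.
- exact: horizontal_curve_loop.
- exact: loop0.
- exact: loop1.
Qed.
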